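(* Two finite simplicial complexes $K$ and $L$ have the same strong homotopy type if and only if $K\sim L$, i.e. if and only if there exists a strong equivalence $\varphi:K\to L$.
   Context: All simplicial complexes are finite (simplices are nonempty finite sets of vertices). For a vertex $v$ of a complex $K$, the link $\mathrm{lk}_K(v)$ is the subcomplex of simplices $\tau\in K$ with $v\notin\tau$ and $\tau\cup\{v\}\in K$, and $K\smallsetminus v$ is the full subcomplex of $K$ spanned by the vertices different from $v$. A simplicial cone is a complex $aM$, the join of a (possibly empty) complex $M$ and a vertex $a$ not in $M$; its simplices are $\{a\}$, the simplices $\tau$ of $M$, and the sets $\{a\}\cup\tau$ with $\tau\in M$. A vertex $v$ of $K$ is dominated if $\mathrm{lk}_K(v)$ is a simplicial cone; in that case there is an elementary strong collapse from $K$ to $K\smallsetminus v$. A strong collapse from $K$ to a subcomplex $L$ is a finite (possibly empty) sequence of elementary strong collapses starting in $K$ and ending in $L$; its inverse is a strong expansion. Two complexes have the same strong homotopy type if there is a sequence of strong collapses and strong expansions that starts in one and ends in the other. Two simplicial maps $\varphi,\psi:K\to L$ are contiguous if $\varphi(\sigma)\cup\psi(\sigma)$ is a simplex of $L$ for every simplex $\sigma\in K$. The equivalence classes of the equivalence relation generated by contiguity are called contiguity classes, and $\varphi\sim\psi$ means that $\varphi$ and $\psi$ lie in the same contiguity class. A simplicial map $\varphi:K\to L$ is a strong equivalence if there is a simplicial map $\psi:L\to K$ such that $\psi\varphi\sim 1_K$ and $\varphi\psi\sim 1_L$. *)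

(* Defs.v *)
From Stdlib Require Import Relations.
From HB Require Import structures.
From mathcomp Require Import all_boot.
From mathcomp Require Import finmap.

Set Implicit Arguments.
Unset Strict Implicit.
Unset Printing Implicit Defensive.

Local Open Scope fset_scope.

(* Vertices are taken from a universe V. In the statement V is infinite, so    *)
(* that strong expansions can always use fresh vertices.                       *)

Section Complexes.
Variable V : choiceType.
Implicit Types (S : {fset {fset V}}) (s t : {fset V}) (v a : V).

Definition is_complex S : bool :=
  (fset0 \notin S) &&
  [forall s : S, [forall t : fpowerset (val s),
     (val t != fset0) ==> (val t \in S)]].

(* The closure condition is boolean so that two complexes with the same        *)
(* simplices are equal.                                                        *)
Record complex := Complex { simplices : {fset {fset V}};
                            _ : is_complex simplices }.

HB.instance Definition _ := [isSub for simplices].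

Implicit Types K L M C : complex.

Lemma is_complexP S :
  reflect (fset0 \notin S /\
           forall s t, s \in S -> t `<=` s -> t != fset0 -> t \in S)
          (is_complex S).
Proof.
apply: (iffP andP) => -[S0 Scl]; split=> //.
  move=> s t sS ts t0; have tP : t \in fpowerset s by rewrite fpowersetE.
  by move/forallP/(_ [` sS])/forallP/(_ [` tP])/implyP: Scl; apply.
apply/forallP=> s; apply/forallP=> t; apply/implyP=> t0.
by apply: (Scl (val s)); rewrite ?fsvalP // -fpowersetE fsvalP.
Qed.

Lemma complexP K :
  fset0 \notin simplices K /\
  forall s t, s \in simplices K -> t `<=` s -> t != fset0 -> t \in simplices K.
Proof. by apply/is_complexP; case: K. Qed.

Definition vertices K : {fset V} := \bigcup_(s <- simplices K) s.

Definition full_subcomplex_simplices K (A : {fset V}) : {fset {fset V}} :=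
  [fset t in simplices K | t `<=` A].

Lemma full_subcomplex_subproof K A : is_complex (full_subcomplex_simplices K A).
Proof.
have [K0 Kcl] := complexP K; apply/is_complexP; split.
  by rewrite !inE (negbTE K0).
move=> s t; rewrite !inE => /andP[sK sA] ts t0.
by rewrite (Kcl s) //= (fsubset_trans ts).
Qed.

Definition full_subcomplex K A := Complex (full_subcomplex_subproof K A).

Definition deletion K v : complex := full_subcomplex K (vertices K `\ v).

Definition link_simplices K v : {fset {fset V}} :=
  [fset t in simplices K | (v \notin t) && (v |` t \in simplices K)].

Lemma link_subproof K v : is_complex (link_simplices K v).
Proof.
have [K0 Kcl] := complexP K; apply/is_complexP; split.
  by rewrite !inE (negbTE K0).
move=> s t; rewrite !inE => /and3P[sK vs vsK] ts t0; apply/and3P; split.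
- exact: (Kcl s).
- by apply: contra vs; apply: (fsubsetP ts).
- apply: (Kcl _ _ vsK); first by rewrite fsetUS.
  by apply/fset0Pn; exists v; rewrite !inE eqxx.
Qed.

Definition link K v := Complex (link_subproof K v).

Definition cone_simplices a M : {fset {fset V}} :=
  [fset a] |` (simplices M `|` [fset a |` t | t in simplices M]).

Lemma cone_subproof a M : is_complex (cone_simplices a M).
Proof.
have [M0 Mcl] := complexP M; apply/is_complexP; split.
  apply/negP; rewrite !inE (negbTE M0) /= => /orP[/eqP/fsetP/(_ a)|].
    by rewrite !inE eqxx.
  by case/imfsetP=> t _ /fsetP/(_ a); rewrite !inE eqxx.
have key s t : (s == fset0) || (s \in simplices M) -> t `<=` a |` s ->
    t != fset0 -> t \in cone_simplices a M.
  move=> sM ts t0; have ts' : t `\ a `<=` s by rewrite fsubDset.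
  have [tM|] := boolP (t \in simplices M); first by rewrite !inE tM orbT.
  have [at_|nat_] := boolP (a \in t); last first.
    have ts2 : t `<=` s by move: ts'; rewrite mem_fsetD1.
    case/orP: sM => [/eqP s0|sM]; last by rewrite (Mcl s).
    by move: ts2; rewrite s0 fsubset0 (negbTE t0).
  move=> _; have [e|ne] := eqVneq (t `\ a) fset0.
    by rewrite -(fsetD1K at_) e fsetU0 !inE eqxx.
  case/orP: sM => [/eqP s0|sM].
    by move: ts'; rewrite s0 fsubset0 (negbTE ne).
  rewrite !inE; apply/or3P; apply: Or33; apply/imfsetP; exists (t `\ a).
    exact: (Mcl s).
  by rewrite fsetD1K.
move=> s t; rewrite {1}/cone_simplices in_fset1U in_fsetU.
case/or3P=> [/eqP->|sM|/imfsetP[u /= uM ->]] ts t0.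
- by apply: (key fset0); rewrite ?eqxx ?fsetU0.
- by apply: (key s) => //; rewrite ?sM ?orbT // (fsubset_trans ts) ?fsubsetUr.
- by apply: (key u) => //; rewrite uM orbT.
Qed.

Definition cone a M := Complex (cone_subproof a M).

Definition is_simplicial_cone C : Prop :=
  exists a M, a \notin vertices M /\ C = cone a M.

Definition dominated K v : Prop :=
  v \in vertices K /\ is_simplicial_cone (link K v).

Definition elementary_strong_collapse K L : Prop :=
  exists v, dominated K v /\ L = deletion K v.

Definition strong_collapse : complex -> complex -> Prop :=
  clos_refl_trans complex elementary_strong_collapse.

Definition strong_expansion K L : Prop := strong_collapse L K.

Definition same_strong_homotopy_type : complex -> complex -> Prop :=
  clos_refl_trans complex
    (fun K L => strong_collapse K L \/ strong_expansion K L).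

(* A simplicial map is given by a vertex map defined on the whole universe;    *)
(* only its values on the vertices of the source matter, since maps agreeing   *)
(* there are contiguous.                                                       *)
Record simplicial_map K L := SimplicialMap {
  vertex_map :> V -> V;
  simplicial_mapP : forall s, s \in simplices K ->
    [fset vertex_map x | x in s] \in simplices L }.

Lemma id_subproof K s :
  s \in simplices K -> [fset id x | x in s] \in simplices K.
Proof. by rewrite imfset_id. Qed.

Definition simplicial_id K : simplicial_map K K :=
  SimplicialMap (@id_subproof K).

Lemma comp_subproof K L M (psi : simplicial_map L M) (phi : simplicial_map K L) s :
  s \in simplices K -> [fset (psi \o phi) x | x in s] \in simplices M.
Proof.
move=> sK; rewrite (_ : [fset _ | x in s] = [fset psi y | y in [fset phi x | x in s]]).
  exact/simplicial_mapP/simplicial_mapP.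
apply/fsetP=> z; apply/imfsetP/imfsetP => /= -[x xs ->].
  by exists (phi x) => //; apply: in_imfset.
by case/imfsetP: xs => y /= ys ->; exists y.
Qed.

Definition simplicial_comp K L M (psi : simplicial_map L M)
  (phi : simplicial_map K L) : simplicial_map K M :=
  SimplicialMap (@comp_subproof K L M psi phi).

Definition contiguous K L (phi psi : simplicial_map K L) : Prop :=
  forall s, s \in simplices K ->
    [fset phi x | x in s] `|` [fset psi x | x in s] \in simplices L.

Definition same_contiguity_class K L :
  simplicial_map K L -> simplicial_map K L -> Prop :=
  clos_refl_sym_trans (simplicial_map K L) (@contiguous K L).

Definition strong_equivalence K L (phi : simplicial_map K L) : Prop :=
  exists psi : simplicial_map L K,
    same_contiguity_class (simplicial_comp psi phi) (simplicial_id K) /\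
    same_contiguity_class (simplicial_comp phi psi) (simplicial_id L).

End Complexes.

(* Main.v *)
Require Import Defs.
From Stdlib Require Import Relations Classical.
From HB Require Import structures.
From mathcomp Require Import all_boot.
From mathcomp Require Import finmap.

Local Open Scope fset_scope.

(** A vertex [v] is dominated iff some vertex [a <> v] can be added to every
    simplex containing [v]; sending [v] to [a] is then a strong equivalence
    from [K] to the deletion of [v].  Conversely, deleting dominated vertices
    reduces to the case where neither complex has any. A self-map contiguous
    to the identity of such a complex is the identity on vertices, since a
    moved vertex would be dominated by its image; so a strong equivalence is
    an isomorphism.

    Isomorphic complexes are related through pullbacks: for a map [r] from a
    finite set [B] onto the vertices of [K], the subsets of [B] whose image is
    a simplex form a complex, which collapses onto its restriction to any
    subset of [B] that still covers all the values of [r].  Hence two pullbacks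
    along surjections with disjoint domains are both collapses of the pullback
    to the union, and a fresh domain connects two domains that overlap. *)

Section Theory.
Set Implicit Arguments.
Unset Strict Implicit.
Unset Printing Implicit Defensive.
Variable V : choiceType.
Implicit Types (K L M C : complex V) (s t A B D : {fset V}) (v a : V).
Implicit Types (r f g : V -> V).

(** * Simplices, deletions and links *)

Lemma eq_complex K L : simplices K =i simplices L -> K = L.
Proof. by move=> e; apply: val_inj; apply/fsetP. Qed.

Lemma simplex_subset K s t :
  s \in simplices K -> t `<=` s -> t != fset0 -> t \in simplices K.
Proof. by have [_] := complexP K; apply. Qed.

Lemma mem_vertices K v : (v \in vertices K) = ([fset v] \in simplices K).
Proof.
apply/bigfcupP/idP => [[s]|vK]; last by exists [fset v]; rewrite ?inE ?vK ?eqxx.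
rewrite andbT => sK vs; apply: (simplex_subset sK); first by rewrite fsub1set.
by apply/fset0Pn; exists v; rewrite inE.
Qed.

Lemma simplex_vertices K s : s \in simplices K -> s `<=` vertices K.
Proof.
move=> sK; apply/fsubsetP => x xs; rewrite mem_vertices.
apply: (simplex_subset sK); first by rewrite fsub1set.
by apply/fset0Pn; exists x; rewrite inE.
Qed.

Lemma in_deletion K v s :
  (s \in simplices (deletion K v)) = (s \in simplices K) && (v \notin s).
Proof.
rewrite !inE /=; case sK: (s \in _) => //=.
by rewrite fsubsetD1 (simplex_vertices sK).
Qed.

Lemma vertices_deletion K v : vertices (deletion K v) = vertices K `\ v.
Proof.
by apply/fsetP => x; rewrite mem_vertices in_deletion !inE -mem_vertices eq_sym andbC.
Qed.

Lemma in_link K v s : (s \in simplices (link K v)) =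
  [&& s \in simplices K, v \notin s & v |` s \in simplices K].
Proof. by rewrite !inE. Qed.

Lemma fset1U_eq0 a s : (a |` s == fset0) = false.
Proof. by apply/negbTE/fset0Pn; exists a; rewrite !inE eqxx. Qed.

(** A simplex containing [a] is either [[fset a]] or becomes a simplex of [deletion C a] once [a] is
    removed; the others already lie in that base. *)
Lemma cone_deletion C a : [fset a] \in simplices C ->
  (forall t, t \in simplices C -> a |` t \in simplices C) ->
  C = cone a (deletion C a).
Proof.
move=> aC addC; apply: eq_complex => t; apply/idP/idP => [tC|].
  have [at_|nat_] := boolP (a \in t); last first.
    by apply/fsetUP; right; apply/fsetUP; left; rewrite in_deletion tC.
  have [e|ne] := eqVneq (t `\ a) fset0.
    by apply/fsetUP; left; rewrite -(fsetD1K at_) e fsetU0 inE.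
  apply/fsetUP; right; apply/fsetUP; right; apply/imfsetP.
  exists (t `\ a); last by rewrite fsetD1K.
  rewrite /= in_deletion !inE eqxx andbT.
  by apply: (simplex_subset tC) => //; apply: fsubD1set.
case/fsetUP => [|/fsetUP[|/imfsetP[u /= + ->]]].
- by rewrite inE => /eqP->.
- by rewrite in_deletion => /andP[].
- by rewrite in_deletion => /andP[uC _]; apply: addC.
Qed.

Lemma cone_apex a M : [fset a] \in simplices (cone a M).
Proof. by rewrite !inE eqxx. Qed.

Lemma cone_add a M t :
  t \in simplices (cone a M) -> a |` t \in simplices (cone a M).
Proof.
case/fsetUP => [|/fsetUP[tM|/imfsetP[u /= uM ->]]].
- by rewrite inE => /eqP->; rewrite fsetUid cone_apex.
- by apply/fsetUP; right; apply/fsetUP; right; apply: in_imfset.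
- by rewrite fsetUA fsetUid; apply/fsetUP; right; apply/fsetUP; right; apply: in_imfset.
Qed.

(** The witness [a] is the apex of the link. Conversely, such an [a] makes the link a cone with apex
    [a] over the deletion of [a] from the link. *)
Lemma dominatedP K v : dominated K v <->
  v \in vertices K /\ exists2 a, a != v &
    forall s, s \in simplices K -> v \in s -> a |` s \in simplices K.
Proof.
split=> [[vK [a [M [_ lkE]]]]|[vK [a av addK]]]; split=> //.
  have := cone_apex a M; rewrite -lkE in_link !inE => /and3P[_ va vaK].
  exists a => [|s sK vs]; first by rewrite eq_sym.
  (* The simplex [[fset v]] is treated apart: removing [v] leaves the empty set, which is not in the
     link. *)
  have [e|ne] := eqVneq (s `\ v) fset0.
    by rewrite -(fsetD1K vs) e fsetU0 fsetUC.
  have : s `\ v \in simplices (link K v).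
    rewrite in_link fsetD1K // sK !inE eqxx !andbT.
    by apply: (simplex_subset sK) => //; apply: fsubD1set.
  rewrite lkE => /cone_add; rewrite -lkE in_link => /and3P[_ _].
  by rewrite fsetUCA fsetD1K.
have vaK : v |` [fset a] \in simplices K.
  by rewrite fsetUC; apply: addK; rewrite ?inE -?mem_vertices.
exists a, (deletion (link K v) a); split.
  by rewrite vertices_deletion !inE eqxx.
apply: cone_deletion => [|t].
  rewrite in_link vaK !inE eq_sym av !andbT.
  by rewrite (simplex_subset vaK) ?fsubsetUr // -(fsetU0 [fset a]) fset1U_eq0.
rewrite !in_link => /and3P[tK vt vtK].
have avtK := addK _ vtK (fset1U1 _ _).
rewrite fsetUCA avtK !inE negb_or eq_sym av vt !andbT.
by rewrite (simplex_subset avtK) ?fset1U_eq0 // fsetUCA fsubsetUr.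
Qed.

(** * Pullbacks of a complex along vertex maps *)

Definition pullback_simplices r A K : {fset {fset V}} :=
  [fset s in fpowerset A | [fset r x | x in s] \in simplices K].

Lemma pullback_subproof r A K : is_complex (pullback_simplices r A K).
Proof.
apply/is_complexP; split=> [|s t].
  rewrite !inE imfset0 /=.
  by case: (complexP K) => /negbTE->; rewrite andbF.
rewrite !inE !fpowersetE => /andP[sA sK] ts /fset0Pn[x xt].
rewrite (fsubset_trans ts sA) (simplex_subset sK) //.
  exact/subset_imfset/fsubsetP.
by apply/fset0Pn; exists (r x); apply: in_imfset.
Qed.

Definition pullback r A K := Complex (pullback_subproof r A K).

Lemma in_pullback r A K s : (s \in simplices (pullback r A K)) =
  (s `<=` A) && ([fset r x | x in s] \in simplices K).
Proof. by rewrite !inE fpowersetE. Qed.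

Lemma eq_in_pullback r f A K : {in A, r =1 f} -> pullback r A K = pullback f A K.
Proof.
move=> e; apply: eq_complex => s; rewrite !in_pullback.
have [sA|//] := boolP (s `<=` A).
rewrite (_ : [fset r x | x in s] = [fset f x | x in s]) //.
by apply: eq_in_imfset => x xs; apply: e; apply: (fsubsetP sA).
Qed.

(** A point [b] of [B] outside [A] is dominated by any [a] in [A] with the same value, since adding
    [a] to a simplex containing [b] leaves its image unchanged. Such points are deleted one at a
    time. *)
Lemma pullback_strong_collapse r K A B : A `<=` B ->
  (forall b, b \in B -> r b \in vertices K) ->
  (forall b, b \in B -> exists2 a, a \in A & r a = r b) ->
  strong_collapse (pullback r B K) (pullback r A K).
Proof.
elim: {B}_.+1 {-2}B (ltnSn #|` B|) => // n IHn B leBn AB rB rA.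
have [BA|] := boolP (B `<=` A).
  by have -> : A = B; [apply/eqP; rewrite eqEfsubset AB BA | apply: rt_refl].
case/fsubsetPn => b bB bA.
apply: rt_trans (IHn (B `\ b) _ _ _ _); last first.
- by move=> x; rewrite !inE => /andP[_ /rA].
- by move=> x; rewrite !inE => /andP[_ /rB].
- by rewrite fsubsetD1 AB.
- by move: leBn; rewrite ltnS (cardfsD1 b) bB.
apply: rt_step; exists b; split.
  apply/dominatedP; split.
    by rewrite mem_vertices in_pullback fsub1set bB imfset_fset1 -mem_vertices rB.
  have [a aA rab] := rA _ bB; exists a; first by apply: contraNneq bA => <-.
  move=> s; rewrite !in_pullback => /andP[sB sK] bs.
  rewrite fsubUset fsub1set (fsubsetP AB) // sB /= imfsetU1 rab.
  by rewrite mem_fset1U // in_imfset.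
apply: eq_complex => s.
by rewrite in_deletion !in_pullback fsubsetD1 andbAC.
Qed.

Lemma pullback_id K : pullback id (vertices K) K = K.
Proof.
apply: eq_complex => s; rewrite in_pullback imfset_id.
by case sK: (s \in _); rewrite ?andbF ?simplex_vertices.
Qed.

Lemma pullback_disjoint_homotopy f g K A B : [disjoint A & B] ->
  [fset f x | x in A] = vertices K -> [fset g x | x in B] = vertices K ->
  same_strong_homotopy_type (pullback f A K) (pullback g B K).
Proof.
move=> /fdisjointP AB fA gB; pose r x := if x \in A then f x else g x.
have rA : {in A, r =1 f} by move=> x xA; rewrite /r xA.
have rB : {in B, r =1 g} by move=> x xB; rewrite /r; case: ifP => // /AB; rewrite xB.
rewrite -(eq_in_pullback K rA) -(eq_in_pullback K rB).
have rV x : x \in A `|` B -> r x \in vertices K.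
  by case/fsetUP => xAB; [rewrite rA // -fA | rewrite rB // -gB]; apply: in_imfset.
apply: (rt_trans _ _ _ (pullback r (A `|` B) K)); apply: rt_step; [right|left].
  apply: pullback_strong_collapse => [|//|x /rV]; first exact: fsubsetUl.
  by rewrite -fA => /imfsetP[a /= aA ->]; exists a => //; apply: rA.
apply: pullback_strong_collapse => [|//|x /rV]; first exact: fsubsetUr.
by rewrite -gB => /imfsetP[b /= bB ->]; exists b => //; apply: rB.
Qed.

(** Supplies the fresh domain that links two overlapping ones: each element of [A] receives a new
    point outside [D]. *)
Lemma fresh_surjection A D : (forall B : {fset V}, exists x, x \notin B) ->
  exists (C : {fset V}) g, [disjoint D & C] /\ [fset g x | x in C] = A.
Proof.
move=> inf; elim/finSet_rect: A => A IHA.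
have [->|/fset0Pn[a aA]] := eqVneq A fset0.
  by exists fset0, id; rewrite imfset0 fdisjointX0.
have [C [g [DC gC]]] := IHA _ (fproperD1 aA).
have [c] := inf (D `|` C); rewrite inE negb_or => /andP[cD cC].
exists (c |` C), (fun x => if x == c then a else g x); split.
  by rewrite fdisjointXU fdisjointX1 cD.
rewrite imfsetU1 eqxx -[RHS](fsetD1K aA) -gC; congr (_ |` _).
by apply: eq_in_imfset => x xC; case: eqP xC cC => // -> ->.
Qed.

(** * Contiguity classes and strong equivalences *)

Lemma contiguous_sym K L (phi psi : simplicial_map K L) :
  contiguous phi psi -> contiguous psi phi.
Proof. by move=> h s sK; rewrite fsetUC; apply: h. Qed.

(** Replaces equality of simplicial maps, whose values off the vertices of the source are
    arbitrary. *)
Lemma eq_contiguous K L (phi psi : simplicial_map K L) :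
  {in vertices K, phi =1 psi} -> contiguous phi psi.
Proof.
move=> e s sK; rewrite (_ : [fset phi x | x in s] = [fset psi x | x in s]).
  by rewrite fsetUid; apply: simplicial_mapP.
by apply: eq_in_imfset => x xs; apply/e/(fsubsetP (simplex_vertices sK)).
Qed.

Lemma same_class_compl K L M (psi : simplicial_map L M) (f g : simplicial_map K L) :
  same_contiguity_class f g ->
  same_contiguity_class (simplicial_comp psi f) (simplicial_comp psi g).
Proof.
elim=> [x y xy|x|x y _|x y z _ xy _]; first 1 last.
- exact: rst_refl.
- exact: rst_sym.
- exact: rst_trans xy.
apply: rst_step => s sK; have := simplicial_mapP psi (xy s sK).
by rewrite imfsetU -!imfset_comp.
Qed.

Lemma same_class_compr K L M (psi : simplicial_map K L) (f g : simplicial_map L M) :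
  same_contiguity_class f g ->
  same_contiguity_class (simplicial_comp f psi) (simplicial_comp g psi).
Proof.
elim=> [x y xy|x|x y _|x y z _ xy _]; first 1 last.
- exact: rst_refl.
- exact: rst_sym.
- exact: rst_trans xy.
apply: rst_step => s sK; have := xy _ (simplicial_mapP psi sK).
by rewrite -!imfset_comp.
Qed.

Definition strong_equivalent K L :=
  exists phi : simplicial_map K L, strong_equivalence phi.

Lemma strong_equivalent_refl K : strong_equivalent K K.
Proof.
by exists (simplicial_id K), (simplicial_id K); split; apply: rst_step; apply: eq_contiguous.
Qed.

Lemma strong_equivalent_sym K L : strong_equivalent K L -> strong_equivalent L K.
Proof. by case=> phi [psi [h1 h2]]; exists psi, phi. Qed.

(** The inner composite [psi' phi'] is first moved to the identity of [L], between [psi] and [phi];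
    then [psi phi] is moved to the identity of [K]. *)
Lemma same_class_comp_inverse K L M
    (phi : simplicial_map K L) (psi : simplicial_map L K)
    (phi' : simplicial_map L M) (psi' : simplicial_map M L) :
  same_contiguity_class (simplicial_comp psi phi) (simplicial_id K) ->
  same_contiguity_class (simplicial_comp psi' phi') (simplicial_id L) ->
  same_contiguity_class
    (simplicial_comp (simplicial_comp psi psi') (simplicial_comp phi' phi))
    (simplicial_id K).
Proof.
move=> h /(same_class_compr phi)/(same_class_compl psi) h'.
apply: rst_trans (rst_step _ _ _ _ _) (rst_trans _ _ _ _ _ h' (rst_trans _ _ _ _ _ _ h)).
  exact: eq_contiguous.
by apply: rst_step; apply: eq_contiguous.
Qed.

Lemma strong_equivalent_trans K L M :
  strong_equivalent K L -> strong_equivalent L M -> strong_equivalent K M.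
Proof.
move=> [phi [psi [h1 h2]]] [phi' [psi' [h1' h2']]].
exists (simplicial_comp phi' phi), (simplicial_comp psi psi').
by split; apply: same_class_comp_inverse.
Qed.

(** * Strong collapses are strong equivalences *)

Lemma elementary_strong_collapse_equivalent K L :
  elementary_strong_collapse K L -> strong_equivalent K L.
Proof.
case=> v [/dominatedP[vK [a av addK]] ->].
pose r x := if x == v then a else x.
have r_id s : v \notin s -> [fset r x | x in s] = s.
  move=> vs; rewrite -[RHS]imfset_id; apply: eq_in_imfset => x xs.
  by rewrite /r; case: eqP xs vs => // -> ->.
have r_v s : v \in s -> [fset r x | x in s] = a |` s `\ v.
  move=> vs; rewrite -[s `\ v]r_id; last by rewrite !inE eqxx.
  have -> : a = r v by rewrite /r eqxx.
  by rewrite -imfsetU1 fsetD1K.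
have rP s : s \in simplices K -> [fset r x | x in s] \in simplices (deletion K v).
  move=> sK; rewrite in_deletion; have [vs|vs] := boolP (v \in s); last first.
    by rewrite r_id // sK.
  rewrite r_v // !inE eqxx negb_or eq_sym av andbT.
  by rewrite (simplex_subset (addK _ sK vs)) ?fset1U_eq0 ?fsetUS ?fsubD1set.
have iP s : s \in simplices (deletion K v) -> [fset id x | x in s] \in simplices K.
  by rewrite in_deletion imfset_id => /andP[].
exists (SimplicialMap rP), (SimplicialMap iP); split; apply: rst_step.
  move=> s sK; rewrite imfset_id /=.
  have [vs|vs] := boolP (v \in s); last by rewrite r_id // fsetUid.
  by rewrite r_v // -fsetUA (fsetUidPr _ _ (fsubD1set _ _)) addK.
apply: eq_contiguous => x /=; rewrite vertices_deletion !inE /r => /andP[].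
by case: eqP.
Qed.

Lemma strong_collapse_equivalent K L : strong_collapse K L -> strong_equivalent K L.
Proof.
elim=> [x y|x|x y z _ xy _]; first exact: elementary_strong_collapse_equivalent.
  exact: strong_equivalent_refl.
exact: strong_equivalent_trans.
Qed.

Lemma same_strong_homotopy_type_equivalent K L :
  same_strong_homotopy_type K L -> strong_equivalent K L.
Proof.
elim=> [x y [/strong_collapse_equivalent //|/strong_collapse_equivalent]|x|x y z _ xy _].
- exact: strong_equivalent_sym.
- exact: strong_equivalent_refl.
- exact: strong_equivalent_trans.
Qed.

(** * Complexes without dominated vertices *)

Lemma contiguous_id_minimal K (phi : simplicial_map K K) :
  (forall v, ~ dominated K v) -> contiguous phi (simplicial_id K) ->
  {in vertices K, phi =1 id}.
Proof.
move=> minK phi_id v vK; apply/eqP/negPn/negP => phiv; apply: (minK v).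
apply/dominatedP; split=> //; exists (phi v) => // s sK vs.
apply: (simplex_subset (phi_id _ sK)); last by rewrite fset1U_eq0.
by rewrite imfset_id fsetSU // fsub1set in_imfset.
Qed.

Lemma same_class_id_minimal K (phi : simplicial_map K K) :
  (forall v, ~ dominated K v) -> same_contiguity_class phi (simplicial_id K) ->
  {in vertices K, phi =1 id}.
Proof.
move=> minK phi_id.
(* Stated as an equivalence, the claim passes through the symmetry and transitivity cases of the
   induction. *)
suff [_] : {in vertices K, phi =1 id} <-> {in vertices K, simplicial_id K =1 id}.
  by apply.
elim: phi_id => [f g fg|f|f g _|f g h _ fg _]; last exact: iff_trans.
2: by split.
2: exact: iff_sym.
have step (f' g' : simplicial_map K K) : contiguous f' g' ->
    {in vertices K, f' =1 id} -> {in vertices K, g' =1 id}.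
  move=> f'g' f'_id; apply: contiguous_id_minimal => // s sK.
  have -> : [fset simplicial_id K x | x in s] = [fset f' x | x in s].
    apply: eq_in_imfset => x xs; rewrite f'_id //.
    exact: (fsubsetP (simplex_vertices sK)).
  exact: (contiguous_sym f'g').
by split; apply: step => //; apply: contiguous_sym.
Qed.

(** * From strong equivalence to strong homotopy type *)

Lemma map_vertices K L (phi : simplicial_map K L) x :
  x \in vertices K -> phi x \in vertices L.
Proof. by rewrite !mem_vertices => /(simplicial_mapP phi); rewrite imfset_fset1. Qed.

Lemma isomorphic_homotopy K L (phi : simplicial_map K L) (psi : simplicial_map L K) :
  (forall A : {fset V}, exists x, x \notin A) ->
  {in vertices K, psi \o phi =1 id} -> {in vertices L, phi \o psi =1 id} ->
  same_strong_homotopy_type K L.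
Proof.
move=> inf psiphi phipsi.
(* If the image of [s] under [psi] is a simplex of [K], applying [phi] gives back [s] as a simplex
   of [L]. Thus both complexes are pullbacks of [K]: [L] along [psi], and [K] along [id]. *)
have LE : L = pullback psi (vertices L) K.
  apply: eq_complex => s; rewrite in_pullback; apply/idP/andP => [sL|[sL sK]].
    by split; [apply: simplex_vertices | apply: simplicial_mapP].
  have := simplicial_mapP phi sK; rewrite -(imfset_comp _ psi).
  rewrite (_ : imfset _ _ _ = s) // -[RHS]imfset_id.
  by apply: eq_in_imfset => x xs; apply: phipsi; apply: (fsubsetP sL).
have psiL : [fset psi x | x in vertices L] = vertices K.
  apply/fsetP => x; apply/imfsetP/idP => [[y /= yL ->]|xK]; first exact: map_vertices.
  by exists (phi x); [apply: map_vertices | rewrite -[LHS](psiphi _ xK)].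
have [C [g []]] := fresh_surjection (vertices K) (vertices K `|` vertices L) inf.
rewrite fdisjointUX => /andP[KC LC] gC.
rewrite LE -{1}(pullback_id K); apply: (rt_trans _ _ _ (pullback g C K)).
  by apply: pullback_disjoint_homotopy; rewrite ?imfset_id.
by apply: pullback_disjoint_homotopy; rewrite // fdisjoint_sym.
Qed.

Lemma strong_equivalent_homotopy K L :
  (forall A : {fset V}, exists x, x \notin A) ->
  strong_equivalent K L -> same_strong_homotopy_type K L.
Proof.
move=> inf.
have del_lt M v : dominated M v -> #|` vertices (deletion M v)| < #|` vertices M|.
  by case=> vM _; rewrite vertices_deletion [ltnRHS](cardfsD1 v) vM.
have collapse_del M v : dominated M v -> strong_collapse M (deletion M v).
  by move=> domv; apply: rt_step; exists v.
(* Induction on the total number of vertices: deleting a dominated vertex from either complex lowers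
   it and preserves strong equivalence. *)
have [n] := ubnP (#|` vertices K| + #|` vertices L|).
elim: n K L => // n IHn K L; rewrite ltnS => leKL KL.
have [[v domv]|minK] := classic (exists v, dominated K v).
  apply: (rt_trans _ _ _ (deletion K v)); first by apply: rt_step; left; apply: collapse_del.
  apply: IHn; first by apply: leq_trans leKL; rewrite ltn_add2r del_lt.
  apply: strong_equivalent_trans KL.
  by apply/strong_equivalent_sym/strong_collapse_equivalent/collapse_del.
have [[v domv]|minL] := classic (exists v, dominated L v).
  apply: (rt_trans _ _ _ (deletion L v)); last by apply: rt_step; right; apply: collapse_del.
  apply: IHn; first by apply: leq_trans leKL; rewrite ltn_add2l del_lt.
  by apply: strong_equivalent_trans KL _; apply/strong_collapse_equivalent/collapse_del.
(* Neither complex has a dominated vertex now, so both composites are the identity on vertices. *)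
case: KL => phi [psi [psiphi phipsi]].
apply: (isomorphic_homotopy inf (phi := phi) (psi := psi)).
  by apply: same_class_id_minimal psiphi => v domv; apply: minK; exists v.
by apply: same_class_id_minimal phipsi => v domv; apply: minL; exists v.
Qed.

End Theory.

Theorem corollary2p12 (V : choiceType)
    (V_infinite : forall A : {fset V}, exists x : V, x \notin A)
    (K L : complex V) :
  same_strong_homotopy_type K L <->
  exists phi : simplicial_map K L, strong_equivalence phi.
Proof.
split; first exact: same_strong_homotopy_type_equivalent.
exact: strong_equivalent_homotopy.
Qed.
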